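(* Let $n$ be a positive integer and $x>0$. For integers $j\ge 0$ define the rational function $$p_{j}(x) = \sum_{k=1}^{j} \frac{2^{2k}}{2k \binom{2k}{k}} \frac{x}{(1+x^{2})^{k}},$$ and let $g_0(x)=\int_0^x \frac{\ln t\,dt}{1+t^2}$. Then $$\int_{0}^{x} \frac{\ln t \, dt}{(1+t^{2})^{n+1}} = \frac{\binom{2n}{n}}{2^{2n}} \left[ g_{0}(x) + p_{n}(x) \ln x - \sum_{k=1}^{n} \frac{\tan^{-1} x + p_{k-1}(x)}{2k-1} \right].$$
   Context: $\tan^{-1}$ denotes the arctangent function; empty sums are $0$, so $p_0(x)=0$. *)

(* Defs.v *)
From Stdlib Require Import Reals.
From Coquelicot Require Import Coquelicot.
Open Scope R_scope.

(* [Binomial.C] is qualified because Coquelicot's [C] is the type of complex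
   numbers.  [sum_n_m a 1 j] is 0 when j = 0. *)
Definition p (j : nat) (x : R) : R :=
  sum_n_m (fun k : nat =>
    2 ^ (2 * k) / (2 * INR k * Binomial.C (2 * k) k) * (x / (1 + x ^ 2) ^ k))
    1 j.

(* The integrand is unbounded at 0, so the integral is improper there. *)
Definition g0 (x : R) : R :=
  RInt_gen (fun t : R => ln t / (1 + t ^ 2)) (at_right 0) (at_point x).

(* Main.v *)
(* With u = 1 + t^2, the derivative of [t ln t / u^n] is
   [2n ln t / u^(n+1) - (2n-1) ln t / u^n + 1 / u^n], and that of [t / u^n] is
   [2n / u^(n+1) - (2n-1) / u^n].  Summing these relations with c_n = C(2n,n) / 4^n shows that
   [atan + p n] is a primitive of [1 / (c_n u^(n+1))] and that the bracket of the
   theorem without [g0] is a primitive of [ln t / (c_n u^(n+1)) - ln t / u].  The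
   latter is continuous at 0 with value 0, because [t ln t] tends to 0. *)
Require Import Defs.
From Stdlib Require Import Reals Lra Lia.
From Coquelicot Require Import Coquelicot.
Open Scope R_scope.

(** * Improper integrals by primitives *)

(** On [[t, b]] with [a < t < b] the ordinary fundamental theorem gives [F b - F t]; continuity of
    [F] at [a] then lets [t] tend to [a]. Nothing is asked of [f] at [a], where it may blow up. *)
Lemma is_RInt_gen_at_right_derive (F f : R -> R) (a b : R) :
  a < b ->
  (forall t, a < t <= b -> is_derive F t (f t)) ->
  (forall t, a < t <= b -> continuous f t) ->
  continuous F a ->
  is_RInt_gen f (at_right a) (at_point b) (F b - F a).
Proof.
intros Hab HF Hf Ha P HP.
assert (Hlim : continuous (fun t => F b - F t) a).
{ apply (continuous_minus (V := R_NormedModule) (fun _ => F b) F);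
    [apply continuous_const | exact Ha]. }
apply (Filter_prod _ _ _ (fun t => a < t < b /\ P (F b - F t)) (fun y => y = b)).
- apply filter_and.
  + assert (Hd : 0 < b - a) by lra. exists (mkposreal _ Hd). intros t Ht Hat.
    split; [exact Hat|].
    change (Rabs (t - a) < b - a) in Ht. apply Rabs_def2 in Ht. lra.
  + apply filter_le_within, (Hlim P HP).
- reflexivity.
- intros t y [Ht HPt] ->. exists (F b - F t). split; [|exact HPt].
  apply (is_RInt_derive F f); simpl; rewrite Rmin_left, Rmax_right by lra;
    intros s Hs; [apply HF | apply Hf]; lra.
Qed.

(** * Continuity of [t ln t] and convergence of the base integral *)

Lemma ln_nonpos (t : R) : t <= 0 -> ln t = 0.
Proof. intros Ht. unfold ln. destruct (Rlt_dec 0 t); [exfalso; lra | reflexivity]. Qed.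

(** Squeeze by [|t ln t| <= t^2 + 2 sqrt t]. For [t > 0] this comes from [ln y < y] at [y = t] and
    at [y = 1 / sqrt t]; for [t <= 0] the left side is 0, as [ln] is 0 there. *)
Lemma continuous_x_ln_0 : continuous (fun t => t * ln t) 0.
Proof.
assert (Hle : forall t, Rabs (t * ln t) <= Rabs t * Rabs t + 2 * sqrt t).
{ intros t. destruct (Rle_or_lt t 0) as [Ht|Ht].
  - rewrite ln_nonpos by exact Ht. rewrite Rmult_0_r, Rabs_R0.
    pose proof (sqrt_pos t). pose proof (Rabs_pos t). nra.
  - pose proof (sqrt_lt_R0 t Ht) as Hs. pose proof (sqrt_sqrt t (Rlt_le _ _ Ht)) as Hss.
    assert (Hln : forall y, 0 < y -> ln y < y).
    { intros y Hy. apply exp_lt_inv. rewrite exp_ln by exact Hy.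
      pose proof (exp_ineq1 y). lra. }
    assert (Hup := Hln t Ht).
    assert (Hlow := Hln (/ sqrt t) (Rinv_0_lt_compat _ Hs)).
    (* [ln t = - 2 ln (1 / sqrt t)], so [|t ln t| <= 2 sqrt t] for [t <= 1]. *)
    rewrite ln_Rinv in Hlow by exact Hs.
    assert (Hln2 : ln t = 2 * ln (sqrt t)).
    { rewrite <- Hss at 1. rewrite ln_mult by exact Hs. ring. }
    assert (Hinv : t * / sqrt t = sqrt t).
    { rewrite <- Hss at 1. field. lra. }
    rewrite (Rabs_pos_eq t) by lra. apply Rabs_le. nra. }
assert (Hg : continuous (fun t => Rabs t * Rabs t + 2 * sqrt t) 0).
{ apply (continuous_plus (fun t => Rabs t * Rabs t) (fun t => 2 * sqrt t)).
  - apply (continuous_mult Rabs Rabs); apply continuous_Rabs.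
  - apply (continuous_mult (fun _ => 2) sqrt);
      [apply continuous_const | apply continuous_sqrt]. }
apply filterlim_locally. intros eps.
generalize (proj1 (filterlim_locally _ _) Hg eps).
apply filter_imp. intros t Ht.
change (Rabs (t * ln t - 0 * ln 0) < eps).
change (Rabs (Rabs t * Rabs t + 2 * sqrt t - (Rabs 0 * Rabs 0 + 2 * sqrt 0)) < eps) in Ht.
rewrite Rabs_R0, sqrt_0 in Ht. apply Rabs_def2 in Ht.
replace (t * ln t - 0 * ln 0) with (t * ln t) by ring.
specialize (Hle t). lra.
Qed.

Lemma continuous_inv_pow (m : nat) (t : R) :
  continuous (fun s => / (1 + s ^ 2) ^ m) t.
Proof.
apply (ex_derive_continuous (V := R_NormedModule)).
auto_derive. apply pow_nonzero. nra.
Qed.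

(* [ln] is 0 on the nonpositive reals, so continuity holds on all of R. *)
Lemma continuous_x_ln (t : R) : continuous (fun s => s * ln s) t.
Proof.
destruct (Rtotal_order t 0) as [Ht|[->|Ht]].
- apply (continuous_ext_loc _ (fun _ => 0)); [|apply continuous_const].
  apply (filter_imp (fun s => s < 0)); [|apply (open_lt 0 t Ht)].
  intros s Hs. rewrite ln_nonpos by lra. symmetry. apply Rmult_0_r.
- exact continuous_x_ln_0.
- apply (ex_derive_continuous (V := R_NormedModule)). auto_derive. exact Ht.
Qed.

Lemma continuous_ln_div_pow (m : nat) (t : R) :
  0 < t -> continuous (fun s => ln s / (1 + s ^ 2) ^ m) t.
Proof.
intros Ht. apply (continuous_mult ln (fun s => / (1 + s ^ 2) ^ m)).
- apply (ex_derive_continuous (V := R_NormedModule)). auto_derive. lra.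
- apply continuous_inv_pow.
Qed.

Lemma continuous_ln_div (t : R) :
  0 < t -> continuous (fun s => ln s / (1 + s ^ 2)) t.
Proof.
intros Ht. apply (continuous_ext (fun s => ln s / (1 + s ^ 2) ^ 1)).
- intros s. rewrite pow_1. reflexivity.
- apply continuous_ln_div_pow, Ht.
Qed.

(* [ln t / (1 + t^2)] is [ln t], the derivative of [t ln t - t], minus
   [t^2 ln t / (1 + t^2)], which extends continuously to [0]. *)
Lemma ex_RInt_gen_ln_div (x : R) : 0 < x ->
  ex_RInt_gen (fun t => ln t / (1 + t ^ 2)) (at_right 0) (at_point x).
Proof.
intros Hx.
(* The exponent 1 matches the form of [continuous_inv_pow]. *)
set (h := fun t => (t * ln t) * (t * / (1 + t ^ 2) ^ 1)).
assert (Hh : forall t, continuous h t).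
{ intros t. apply (continuous_mult (fun t => t * ln t)).
  - apply continuous_x_ln.
  - apply (continuous_mult (fun t : R => t)); [apply continuous_id | apply continuous_inv_pow]. }
assert (HI : forall t, is_derive (RInt h 0) t (h t)).
{ intros t. apply (is_derive_RInt h _ 0); [|apply Hh].
  apply filter_forall. intros s. apply (RInt_correct h).
  apply (ex_RInt_continuous h). intros; apply Hh. }
set (F := fun t => t * ln t - t - RInt h 0 t).
exists (F x - F 0). apply is_RInt_gen_at_right_derive; [exact Hx | | |].
- intros t Ht.
  replace (ln t / (1 + t ^ 2)) with (ln t - h t) by (unfold h; field; nra).
  apply (is_derive_minus (fun t => t * ln t - t)); [|apply HI].
  auto_derive; [lra | field; lra].
- intros t Ht. apply continuous_ln_div, Ht.
- apply (continuous_minus (V := R_NormedModule) (fun t => t * ln t - t)).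
  + apply (continuous_minus (V := R_NormedModule) (fun t => t * ln t));
      [apply continuous_x_ln | apply continuous_id].
  + apply (ex_derive_continuous (V := R_NormedModule)). exists (h 0). apply HI.
Qed.

(** * The coefficients of [p] and the rational primitive *)

Lemma p_S (j : nat) (t : R) :
  p (S j) t = p j t +
    2 ^ (2 * S j) / (2 * INR (S j) * Binomial.C (2 * S j) (S j)) *
      (t / (1 + t ^ 2) ^ S j).
Proof. unfold p. rewrite sum_n_Sm by lia. reflexivity. Qed.

Lemma p_0_l (t : R) : p 0 t = 0.
Proof. unfold p. rewrite sum_n_m_zero by lia. reflexivity. Qed.

Lemma p_0_r (j : nat) : p j 0 = 0.
Proof.
induction j as [|j IH]; [apply p_0_l|]. rewrite p_S, IH. unfold Rdiv. ring.
Qed.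

(** The Wallis ratio [(2n-1)!! / (2n)!!], written [c_n] in comments. *)
Definition central_ratio (n : nat) : R := Binomial.C (2 * n) n / 2 ^ (2 * n).

Lemma central_ratio_0 : central_ratio 0 = 1.
Proof. unfold central_ratio, Binomial.C. simpl. field. Qed.

Lemma central_ratio_pos (n : nat) : 0 < central_ratio n.
Proof.
unfold central_ratio, Binomial.C. apply Rdiv_lt_0_compat; [|apply pow_lt; lra].
apply Rdiv_lt_0_compat; [|apply Rmult_lt_0_compat]; apply INR_fact_lt_0.
Qed.

Lemma central_ratio_S (n : nat) :
  central_ratio (S n) = central_ratio n * ((2 * INR n + 1) / (2 * INR n + 2)).
Proof.
unfold central_ratio, Binomial.C.
replace (2 * S n - S n)%nat with (S n) by lia.
replace (2 * n - n)%nat with n by lia.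
replace (2 * S n)%nat with (S (S (2 * n))) by lia.
rewrite !fact_simpl, !mult_INR, !S_INR, mult_INR. simpl (INR 2).
simpl pow.
pose proof (pos_INR n). pose proof (INR_fact_neq_0 n).
assert (2 ^ (n + (n + 0)) <> 0) by (apply pow_nonzero; lra).
field. repeat split; lra.
Qed.

(** The left side is [1 / ((2k+2) c_(k+1))], and [(2k+2) c_(k+1) = (2k+1) c_k]. The right-hand form
    is the one that makes the derivatives below telescope. *)
Lemma p_coeff (k : nat) :
  2 ^ (2 * S k) / (2 * INR (S k) * Binomial.C (2 * S k) (S k)) =
  / ((2 * INR k + 1) * central_ratio k).
Proof.
pose proof (central_ratio_pos (S k)) as HS.
transitivity (/ (2 * INR (S k) * central_ratio (S k))).
- unfold central_ratio in *.
  assert (H2 : 2 ^ (2 * S k) <> 0) by (apply pow_nonzero; lra).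
  assert (HC : Binomial.C (2 * S k) (S k) <> 0).
  { intros E. rewrite E in HS. unfold Rdiv in HS. lra. }
  field. repeat split; try assumption. apply not_0_INR; lia.
- rewrite central_ratio_S, S_INR.
  pose proof (pos_INR k). pose proof (central_ratio_pos k). field. lra.
Qed.

Lemma p_S_ratio (j : nat) (t : R) :
  p (S j) t = p j t + / ((2 * INR j + 1) * central_ratio j) * (t / (1 + t ^ 2) ^ S j).
Proof. rewrite p_S, p_coeff. reflexivity. Qed.

(** Induction on [j], with [u = 1 + t^2]. The derivative of [t / u^(j+1)] is
    [(2j+2) / u^(j+2) - (2j+1) / u^(j+1)]. After division by [(2j+1) c_j], the second term cancels
    the previous derivative [1 / (c_j u^(j+1))] and the first is [1 / (c_(j+1) u^(j+2))]. *)
Lemma is_derive_atan_p (j : nat) (t : R) :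
  is_derive (fun s => atan s + p j s) t
    (/ (central_ratio j * (1 + t ^ 2) ^ S j)).
Proof.
assert (Hu : 1 + t ^ 2 <> 0) by nra.
induction j as [|j IH].
- apply (is_derive_ext atan); [intros s; rewrite p_0_l; symmetry; apply Rplus_0_r|].
  rewrite central_ratio_0, Rmult_1_l, pow_1. apply is_derive_Reals, derivable_pt_lim_atan.
- apply (is_derive_ext (fun s => (atan s + p j s) +
    / ((2 * INR j + 1) * central_ratio j) * (s / (1 + s ^ 2) ^ S j))).
  { intros s. rewrite p_S_ratio. apply Rplus_assoc. }
  pose proof (central_ratio_pos j). pose proof (pos_INR j).
  assert (Hpow : (1 + t ^ 2) ^ j <> 0) by (apply pow_nonzero; exact Hu).
  replace (/ (central_ratio (S j) * (1 + t ^ 2) ^ S (S j))) with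
    (/ (central_ratio j * (1 + t ^ 2) ^ S j) +
     / ((2 * INR j + 1) * central_ratio j) *
     ((1 + t ^ 2 - 2 * INR (S j) * t ^ 2) / (1 + t ^ 2) ^ S (S j))).
  2:{ rewrite central_ratio_S, S_INR. cbn [pow] in *. field.
      repeat split; try assumption; nra. }
  apply (is_derive_plus (fun s => atan s + p j s)); [exact IH|].
  apply (is_derive_scal (fun s => s / (1 + s ^ 2) ^ S j)).
  auto_derive; [apply (pow_nonzero _ (S j)); nra|].
  change (match j with 0%nat => 1 | S _ => INR j + 1 end) with (INR (S j)).
  rewrite S_INR. cbn [pred pow] in *. field. split; [assumption | nra].
Qed.

(** * The logarithmic primitive *)

Definition ln_primitive (n : nat) (t : R) : R :=
  p n t * ln t
  - sum_n_m (fun k => (atan t + p (k - 1) t) / (2 * INR k - 1)) 1 n.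

Lemma ln_primitive_0_l (t : R) : ln_primitive 0 t = 0.
Proof.
unfold ln_primitive. rewrite p_0_l, sum_n_m_zero by lia.
change (0 * ln t - 0 = 0). ring.
Qed.

(** Here [ln] occurs in the increment only through [t * ln t], so both the derivative and the
    continuity at 0 follow by induction on [n]. *)
Lemma ln_primitive_S (n : nat) (t : R) :
  ln_primitive (S n) t = ln_primitive n t +
    (/ ((2 * INR n + 1) * central_ratio n) * ((t * ln t) * / (1 + t ^ 2) ^ S n)
     - / (2 * INR n + 1) * (atan t + p n t)).
Proof.
unfold ln_primitive. rewrite sum_n_Sm, p_S_ratio by lia.
replace (S n - 1)%nat with n by lia.
change plus with Rplus.
rewrite S_INR.
replace (2 * (INR n + 1) - 1) with (2 * INR n + 1) by ring.
unfold Rdiv. ring.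
Qed.

Lemma ln_primitive_0_r (n : nat) : ln_primitive n 0 = 0.
Proof.
induction n as [|n IH]; [apply ln_primitive_0_l|].
rewrite ln_primitive_S, IH, p_0_r, atan_0. ring.
Qed.

(** In the derivative of the increment, the log-free term [1 / ((2n+1) c_n u^(n+1))] coming from
    [t ln t / u^(n+1)] is cancelled by the derivative of [atan + p n]. The terms in [ln t] telescope
    as in [is_derive_atan_p]. *)
Lemma is_derive_ln_primitive (n : nat) (t : R) : 0 < t ->
  is_derive (ln_primitive n) t
    (/ central_ratio n * (ln t / (1 + t ^ 2) ^ S n) - ln t / (1 + t ^ 2)).
Proof.
intros Ht. assert (Hu : 1 + t ^ 2 <> 0) by nra.
induction n as [|n IH].
- apply (is_derive_ext (fun _ => 0)); [intros s; symmetry; apply ln_primitive_0_l|].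
  rewrite central_ratio_0.
  replace (_ - _) with 0 by (field; exact Hu). apply (is_derive_const 0).
- eapply is_derive_ext; [intros s; symmetry; apply ln_primitive_S|].
  pose proof (central_ratio_pos n). pose proof (pos_INR n).
  assert (Hpow : (1 + t ^ 2) ^ n <> 0) by (apply pow_nonzero; exact Hu).
  match goal with |- is_derive _ _ ?d => replace d with
    ((/ central_ratio n * (ln t / (1 + t ^ 2) ^ S n) - ln t / (1 + t ^ 2)) +
     (/ ((2 * INR n + 1) * central_ratio n) *
       ((ln t + 1) / (1 + t ^ 2) ^ S n
        - 2 * INR (S n) * t ^ 2 * ln t / (1 + t ^ 2) ^ S (S n))
      - / (2 * INR n + 1) * / (central_ratio n * (1 + t ^ 2) ^ S n))) end.
  2:{ rewrite central_ratio_S, S_INR. cbn [pow] in *. field.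
      repeat split; try assumption; nra. }
  apply (is_derive_plus (ln_primitive n)); [exact IH|].
  apply (is_derive_minus (fun s => / ((2 * INR n + 1) * central_ratio n) *
    (s * ln s * / (1 + s ^ 2) ^ S n)) (fun s => / (2 * INR n + 1) * (atan s + p n s))).
  + apply (is_derive_scal (fun s => s * ln s * / (1 + s ^ 2) ^ S n)).
    auto_derive; [split; [lra | split; [apply (pow_nonzero _ (S n)); nra | exact I]]|].
    change (match n with 0%nat => 1 | S _ => INR n + 1 end) with (INR (S n)).
    rewrite S_INR. cbn [pred pow] in *. field. repeat split; try assumption; nra.
  + apply (is_derive_scal (fun s => atan s + p n s)), is_derive_atan_p.
Qed.

Lemma continuous_ln_primitive (n : nat) (t : R) : continuous (ln_primitive n) t.
Proof.
induction n as [|n IH].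
- apply (continuous_ext (fun _ => 0)); [intros s; symmetry; apply ln_primitive_0_l|].
  apply continuous_const.
- eapply continuous_ext; [intros s; symmetry; apply ln_primitive_S|].
  apply (continuous_plus (V := R_NormedModule) (ln_primitive n)); [exact IH|].
  apply (continuous_minus (V := R_NormedModule) (fun s => / ((2 * INR n + 1) * central_ratio n) *
    (s * ln s * / (1 + s ^ 2) ^ S n)) (fun s => / (2 * INR n + 1) * (atan s + p n s))).
  + apply (continuous_scal_r (V := R_NormedModule) _
      (fun s => s * ln s * / (1 + s ^ 2) ^ S n)).
    apply (continuous_mult (fun s => s * ln s));
      [apply continuous_x_ln | apply continuous_inv_pow].
  + apply (continuous_scal_r (V := R_NormedModule) _ (fun s => atan s + p n s)).
    apply (ex_derive_continuous (V := R_NormedModule)). eexists. apply is_derive_atan_p.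
Qed.

(** * Assembly of the integral formula *)

Theorem theorem6p7 (n : nat) (x : R) (hn : (0 < n)%nat) (hx : 0 < x) :
  ex_RInt_gen (fun t : R => ln t / (1 + t ^ 2)) (at_right 0) (at_point x) /\
  ex_RInt_gen (fun t : R => ln t / (1 + t ^ 2) ^ (n + 1))
    (at_right 0) (at_point x) /\
  RInt_gen (fun t : R => ln t / (1 + t ^ 2) ^ (n + 1))
    (at_right 0) (at_point x) =
  Binomial.C (2 * n) n / 2 ^ (2 * n) *
    (g0 x + p n x * ln x
     - sum_n_m (fun k : nat => (atan x + p (k - 1) x) / (2 * INR k - 1)) 1 n).
Proof.
pose proof (ex_RInt_gen_ln_div x hx) as H0.
assert (Hn : is_RInt_gen (fun t => ln t / (1 + t ^ 2) ^ (n + 1))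
  (at_right 0) (at_point x) (central_ratio n * (g0 x + ln_primitive n x))).
{ pose proof (central_ratio_pos n).
  assert (HA : is_RInt_gen
    (fun t => / central_ratio n * (ln t / (1 + t ^ 2) ^ S n) - ln t / (1 + t ^ 2))
    (at_right 0) (at_point x) (ln_primitive n x)).
  { replace (ln_primitive n x) with (ln_primitive n x - ln_primitive n 0)
      by (rewrite ln_primitive_0_r; apply Rminus_0_r).
    apply is_RInt_gen_at_right_derive; [exact hx | | | apply continuous_ln_primitive].
    - intros t Ht. apply is_derive_ln_primitive, Ht.
    - intros t Ht. apply (continuous_minus (V := R_NormedModule)
        (fun t => / central_ratio n * (ln t / (1 + t ^ 2) ^ S n))).
      + apply (continuous_scal_r (V := R_NormedModule) _
          (fun t => ln t / (1 + t ^ 2) ^ S n)), continuous_ln_div_pow, Ht.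
      + apply continuous_ln_div, Ht. }
  (* [RInt_gen] is a total operator; the convergence [H0] makes [g0 x] the actual integral. *)
  assert (Hg : is_RInt_gen (fun t => ln t / (1 + t ^ 2)) (at_right 0) (at_point x) (g0 x))
    by exact (RInt_gen_correct (V := R_CompleteNormedModule) _ H0).
  (* Adding the integral [g0 x] removes [- ln t / (1 + t^2)], and scaling by [c_n] clears the factor
     [1 / c_n]. *)
  pose proof (is_RInt_gen_scal _ (central_ratio n) _ (is_RInt_gen_plus _ _ _ _ Hg HA)) as HS.
  revert HS. apply is_RInt_gen_ext. apply filter_forall. intros ab t _.
  rewrite Nat.add_1_r.
  change (central_ratio n * (ln t / (1 + t ^ 2) +
    (/ central_ratio n * (ln t / (1 + t ^ 2) ^ S n) - ln t / (1 + t ^ 2))) =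
    ln t / (1 + t ^ 2) ^ S n).
  field. repeat split; try lra; try nra. apply pow_nonzero; nra. }
split; [exact H0 | split; [eexists; exact Hn|]].
rewrite (is_RInt_gen_unique _ _ Hn). unfold central_ratio, ln_primitive.
apply (f_equal (Rmult _)). symmetry. apply Rplus_assoc.
Qed.
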